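(* Let $X$ be a real Banach space with dual $X^{\ast}$ and let $T:X\rightrightarrows X^{\ast}$ be a set-valued operator. There exists a nonempty closed convex set $C\subseteq X$ such that $T=N_{C}$ if and only if $T$ is maximally monotone and $0_{X^{\ast}}\in\bigcap_{x\in \mathrm{dom}\,T}T(x)$.
   Context: Let $\langle x,x^{\ast}\rangle$ denote the value of $x^{\ast}\in X^{\ast}$ at $x\in X$. Operators are identified with their graphs: $(x,x^{\ast})\in T$ means $x^{\ast}\in T(x)$. An operator $T:X\rightrightarrows X^{\ast}$ is monotone if $\langle x_0-x_1,x_0^{\ast}-x_1^{\ast}\rangle\geq 0$ for all $(x_0,x_0^{\ast}),(x_1,x_1^{\ast})\in T$; it is maximally monotone if it is monotone and not properly contained in any other monotone operator. Its domain is $\mathrm{dom}\,T:=\{x\in X:T(x)\neq\emptyset\}$. The zero element of $X^{\ast}$ is $0_{X^{\ast}}$. The Fenchel subdifferential operator of $f:X\to\mathbb{R}\cup\{+\infty\}$ is $\partial f(x):=\{x^{\ast}\in X^{\ast}: f(y)\geq f(x)+\langle y-x,x^{\ast}\rangle\ \forall y\in X\}$. For $C\subseteq X$, the indicator functional $\delta_C$ equals $0$ on $C$ and $+\infty$ outside $C$, and the normal cone operator to $C$ is $N_C:=\partial\delta_C:X\rightrightarrows X^{\ast}$. *)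

(* Defs.v *)
From HB Require Import structures.
From mathcomp Require Import all_boot all_order all_algebra.
From mathcomp Require Import all_classical all_reals all_analysis.

Set Implicit Arguments.
Unset Strict Implicit.
Unset Printing Implicit Defensive.

Import Order.TTheory GRing.Theory Num.Theory.
Import numFieldNormedType.Exports.

Local Open Scope classical_set_scope.
Local Open Scope ring_scope.

Section dual.
Context {R : realType} (X : normedModType R).

Definition dual_pred : {pred X -> R^o} :=
  mem [set f : X -> R^o | linear f /\ continuous f].

Lemma dual_submod_closed : submod_closed dual_pred.
Proof.
split=> [|a f g /set_mem[lf cf] /set_mem[lg cg]]; apply/mem_set; split.
- by move=> b x y; rewrite -[LHS]/0 -[RHS]/(b *: 0 + 0) scaler0 addr0.
- exact: cst_continuous.
- move=> b x y; rewrite -[LHS]/(a *: f (b *: x + y) + g (b *: x + y)).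
  rewrite lf lg -[(a *: f + g) x]/(a *: f x + g x).
  rewrite -[(a *: f + g) y]/(a *: f y + g y) !scalerDr !scalerA.
  by rewrite [a * b]mulrC addrACA.
- by move=> x; apply: cvgD; [apply: cvgZl_tmp; exact: cf|exact: cg].
Qed.

HB.instance Definition _ :=
  GRing.isSubmodClosed.Build R (X -> R^o) dual_pred dual_submod_closed.

(* The topological dual of X, as a submodule of the pointwise lmodType of all *)
(* functions X -> R^o; in particular 0 and x0s - x1s below are pointwise.     *)
Record dual : Type := Dual {
  dual_fun :> X -> R^o ;
  dual_funP : dual_fun \in dual_pred }.

HB.instance Definition _ := [isSub for dual_fun].
HB.instance Definition _ := [Choice of dual by <:].
HB.instance Definition _ := [SubChoice_isSubLmodule of dual by <:].

Definition pairing (x : X) (xs : dual) : R := xs x.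

End dual.

Section operators.
Context {R : realType} {X : normedModType R}.
Implicit Types T S : X -> set (dual X).

Definition graph T : set (X * dual X) := [set p | T p.1 p.2].

Definition dom T : set X := [set x | T x !=set0].

Definition monotone T := forall p0 p1, graph T p0 -> graph T p1 ->
  0 <= pairing (p0.1 - p1.1) (p0.2 - p1.2).

Definition maximally_monotone T :=
  monotone T /\ forall S, monotone S -> ~ graph T `<` graph S.

(* The functionals of interest take values in R u {+oo}. When f is proper,    *)
(* subdifferential f x is empty at every x with f x = +oo.                    *)
Definition subdifferential (f : X -> \bar R) : X -> set (dual X) :=
  fun x => [set xs | forall y, (f x + (pairing (y - x) xs)%:E <= f y)%E].

Definition indicator (C : set X) : X -> \bar R :=
  fun x => if x \in C then 0%E else +oo%E.

Definition normal_cone (C : set X) : X -> set (dual X) :=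
  subdifferential (indicator C).

End operators.

(* Main.v *)
Require Import Defs.
From mathcomp Require Import all_boot all_order all_algebra.
From mathcomp Require Import all_classical all_reals all_analysis.
From mathcomp Require Import ring lra.
Import Order.TTheory GRing.Theory Num.Theory.
Import numFieldNormedType.Exports.
Local Open Scope classical_set_scope.
Local Open Scope ring_scope.

(** Sufficiency is short. Suppose that [T] is maximally monotone and contains
    [(x, 0)] for every [x] in its domain. Monotonicity of [T] at a pair [(y, f)]
    of [T] and [(x, 0)] says that [f (x - y) <= 0]. So the intersection [C] of
    the half-spaces [{x | f (x - y) <= 0}], over all pairs [(y, f)] of [T], is a
    closed convex set that contains the domain of [T]; in particular every such
    [f] is normal to [C] at [y]. Thus [T] is contained in the normal cone
    operator of [C], which is monotone, and maximality makes them equal.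

    Necessity is Rockafellar's maximality theorem in the case of an indicator
    function. As a normal cone is a cone that contains 0, maximality reduces to
    one geometric fact: a point [x0] outside a nonempty closed convex set [C] is
    strictly separated from [C] by a functional that attains its supremum on [C]
    ([bishop_phelps]). The completeness of the space enters here, through
    Ekeland's variational principle ([ekeland]): it provides a point [x] of [C]
    that almost minimises the distance to [x0], in such a strong sense that
    [x0 - x] lies at positive distance from the cone generated by [C - x]. The
    distance to that cone is a sublinear functional, bounded by the norm and
    vanishing on the cone, and the Hahn-Banach theorem ([hahn_banach]) yields a
    linear functional below it with the same value at [x0 - x].

    Hahn-Banach is obtained from minimal sublinear functionals: Zorn's lemma
    gives one below any sublinear functional, and minimality implies linearity. *)

(** * Sublinear functionals and the Hahn-Banach theorem *)

Section sublinear.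
Context {R : realType} {V : lmodType R}.
Implicit Types (p q : V -> R) (x y v : V).

(** Homogeneity is only required as an inequality, which is what passes to
    infima; equality follows by applying it to [t] and [t^-1]. *)
Definition sublinear p :=
  (forall x y, p (x + y) <= p x + p y) /\
  (forall (t : R) x, 0 <= t -> p (t *: x) <= t * p x).

Lemma sublinear_homo p (t : R) x :
  sublinear p -> 0 <= t -> p (t *: x) = t * p x.
Proof.
move=> [pD pZ]; rewrite le_eqVlt => /predU1P[<-|t0].
  rewrite scale0r mul0r; apply/eqP; rewrite eq_le.
  have := pZ 0 0 (lexx 0); rewrite scale0r mul0r => ->/=.
  by have := pD 0 0; rewrite addr0 lerDl.
apply/eqP; rewrite eq_le pZ ?(ltW t0)//=.
have := pZ t^-1 (t *: x); rewrite invr_ge0 (ltW t0) => /(_ isT).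
have tn0 : t != 0 by rewrite gt_eqF.
by rewrite scalerA mulVf// scale1r ler_pdivlMl.
Qed.

Lemma sublinear0 p : sublinear p -> p 0 = 0.
Proof. by move=> sp; rewrite -(scale0r 0) sublinear_homo// mul0r. Qed.

Lemma sublinearN_le p x : sublinear p -> - p (- x) <= p x.
Proof.
move=> sp; have := sp.1 x (- x); rewrite subrr sublinear0//; lra.
Qed.

(** The sublinear functionals needed below (the tilts, the infimum of a chain,
    the distance to a convex cone) are all infima over an index [i] that may
    change with the vector; this isolates what they share. Subadditivity comes
    from combining near-optimal indices for [x] and [y]. *)
Lemma sublinear_inf {I : Type} (F : V -> I -> R) (D : set I) :
  D !=set0 ->
  (forall x, exists m, forall i, D i -> m <= F x i) ->
  (forall x y i j, D i -> D j ->
    exists2 k, D k & F (x + y) k <= F x i + F y j) ->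
  (forall (t : R) x i, 0 <= t -> D i ->
    exists2 k, D k & F (t *: x) k <= t * F x i) ->
  sublinear (fun x => inf (F x @` D)).
Proof.
move=> [i0 Di0] lbF FD FZ.
have lb x : has_lbound (F x @` D).
  by have [m mP] := lbF x; exists m => _ [i Di <-]; exact: mP.
have n0 x : F x @` D !=set0 by exists (F x i0), i0.
split=> [x y|t x t0].
  have infD i j : D i -> D j -> inf (F (x + y) @` D) <= F x i + F y j.
    move=> Di Dj; have [k Dk kP] := FD x y i j Di Dj.
    by apply: le_trans kP; apply: ge_inf => //; exists k.
  rewrite -lerBlDl; apply: lb_le_inf => // _ [j Dj <-].
  rewrite lerBlDl -lerBlDr; apply: lb_le_inf => // _ [i Di <-].
  by rewrite lerBlDr infD.
have infle i : D i -> inf (F (t *: x) @` D) <= t * F x i.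
  move=> Di; have [k Dk kP] := FZ t x i t0 Di.
  by apply: le_trans kP; apply: ge_inf => //; exists k.
move: t0; rewrite le_eqVlt => /predU1P[t0|t0].
  by rewrite -t0 mul0r; have := infle i0 Di0; rewrite -t0 mul0r.
rewrite -ler_pdivrMl//; apply: lb_le_inf => // _ [i Di <-].
by rewrite ler_pdivrMl// infle.
Qed.

Definition dominated_sublinear q p := sublinear p /\ forall x, p x <= q x.

(** The lowest value of [p] along the ray from [x] of direction [v], after [p v]
    is deducted per unit length. When [p] is sublinear, so is [tilt p v]; it lies
    below [p], and its value at [- v] is at most [- p v]. Thus a minimal [p]
    satisfies [p x <= p (x + v) - p v], which is the missing half of additivity;
    and linear functionals below [tilt p v] coincide with [p] at [v]. *)
Definition tilt p v x := inf ((fun t : R => p (x + t *: v) - t * p v) @`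
  [set t | 0 <= t]).

Lemma tilt_lbound p v x (t : R) : sublinear p -> 0 <= t ->
  - p (- x) <= p (x + t *: v) - t * p v.
Proof.
move=> sp t0; rewrite lerBrDr addrC lerBlDr -sublinear_homo//.
by have := sp.1 (x + t *: v) (- x); rewrite addrAC subrr add0r.
Qed.

Lemma tilt_le p v x (t : R) : sublinear p -> 0 <= t ->
  tilt p v x <= p (x + t *: v) - t * p v.
Proof.
move=> sp t0; apply: ge_inf; last by exists t.
by exists (- p (- x)) => _ [s s0 <-]; exact: tilt_lbound.
Qed.

Lemma sublinear_tilt p v : sublinear p -> sublinear (tilt p v).
Proof.
move=> sp; apply: sublinear_inf.
- by exists 0 => /=.
- by move=> x; exists (- p (- x)) => t t0; exact: tilt_lbound.
- move=> x y s t /= s0 t0; exists (s + t) => /=; first exact: addr_ge0.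
  have := sp.1 (x + s *: v) (y + t *: v); rewrite addrACA -scalerDl; lra.
- move=> s x t /= s0 t0; exists (s * t) => /=; first exact: mulr_ge0.
  by rewrite -scalerA -scalerDr sublinear_homo// mulrBr mulrA.
Qed.

Lemma dominated_tilt p v : sublinear p -> dominated_sublinear p (tilt p v).
Proof.
move=> sp; split; first exact: sublinear_tilt.
move=> x; have := tilt_le p v x 0 sp (lexx 0).
by rewrite scale0r addr0 mul0r subr0.
Qed.

(** Zorn's lemma: along a chain the pointwise infimum is finite because every
    sublinear functional below [q] is bounded below by [- q (- x)] at [x]. *)
Lemma minimal_sublinear q : sublinear q -> exists2 p, dominated_sublinear q p &
  forall p', dominated_sublinear p p' -> p' = p.
Proof.
move=> sq; pose T := {p | dominated_sublinear q p}.
pose R0 (s t : T) := `[< forall x, sval t x <= sval s x >].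
have [||||[p qp] pmin] := @Zorn T R0.
- by move=> t; apply/asboolP.
- move=> r s t /asboolP rs /asboolP st; apply/asboolP => x.
  exact: le_trans (rs x).
- move=> [s sP] [t tP] /asboolP/= st /asboolP/= ts; apply: eq_exist.
  by apply/funext => x; apply/eqP; rewrite eq_le ts st.
- move=> A Atot; have [[a Aa]|A0] := pselect (A !=set0); last first.
    exists (exist _ q (conj sq (fun x => lexx (q x)))) => s As.
    by case: A0; exists s.
  have lb (s : T) x : - q (- x) <= sval s x.
    case: s => s [ss sq'] /=; apply: le_trans (sublinearN_le s x ss).
    by rewrite lerN2.
  pose m x := inf ((fun s : T => sval s x) @` A).
  have mle s x : A s -> m x <= sval s x.
    move=> As; apply: ge_inf; last by exists s.
    by exists (- q (- x)) => _ [r _ <-]; exact: lb.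
  have sm : sublinear m.
    apply: sublinear_inf; first by exists a.
    - by move=> x; exists (- q (- x)) => s _; exact: lb.
    (* of two members of the chain, the lower one serves both summands *)
    - move=> x y s t As At; have [/asboolP ts|/asboolP st] := Atot _ _ As At.
        exists t => //; have := (svalP t).1.1 x y; have := ts x; lra.
      exists s => //; have := (svalP s).1.1 x y; have := st y; lra.
    - by move=> t x s t0 As; exists s => //; exact: (svalP s).1.2.
  have mq : dominated_sublinear q m.
    by split=> // x; rewrite (le_trans (mle a x Aa))//; exact: (svalP a).2.
  by exists (exist _ m mq) => s As; apply/asboolP => x; exact: mle.
exists p => // p' [sp' p'p].
have qp' : dominated_sublinear q p'.
  by split => // x; rewrite (le_trans (p'p x))// qp.2.
by have /(congr1 sval) := pmin (exist _ p' qp') (asboolT p'p).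
Qed.

(** Minimality forces [tilt p y = p]. *)
Lemma minimal_sublinear_additive p :
  sublinear p -> (forall p', dominated_sublinear p p' -> p' = p) ->
  forall x y, p (x + y) = p x + p y.
Proof.
move=> sp pmin x y; apply/eqP; rewrite eq_le sp.1/=.
have := tilt_le p y x 1 sp ler01.
by rewrite (pmin _ (dominated_tilt p y sp)) scale1r mul1r lerBrDr.
Qed.

Lemma minimal_sublinear_linear p :
  sublinear p -> (forall p', dominated_sublinear p p' -> p' = p) ->
  linear (p : V -> R^o).
Proof.
move=> sp pmin; have pD := minimal_sublinear_additive p sp pmin.
have pN x : p (- x) = - p x.
  by apply/eqP; rewrite -addr_eq0 -pD addNr sublinear0.
move=> t x y; rewrite pD; congr (_ + _).
have [t0|t0] := leP 0 t; first exact: sublinear_homo.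
rewrite -[t]opprK scaleNr pN sublinear_homo ?oppr_ge0 ?ltW//.
by rewrite -[RHS]/(- - t * p x) !mulNr.
Qed.

(** A minimal sublinear functional below [tilt q v] is linear; the tilt controls
    its value at [- v], hence from below at [v]. *)
Theorem hahn_banach q v : sublinear q ->
  exists p, [/\ linear (p : V -> R^o), forall x, p x <= q x & p v = q v].
Proof.
move=> sq; have [sv svq] := dominated_tilt q v sq.
have [p [sp pq] pmin] := minimal_sublinear _ sv.
have plin := minimal_sublinear_linear p sp pmin.
exists p; split=> [//|x|].
  exact: le_trans (pq x) (svq x).
apply/eqP; rewrite eq_le (le_trans (pq v)) ?svq//=.
have := le_trans (pq (- v)) (tilt_le q v (- v) 1 sq ler01).
rewrite scale1r addNr sublinear0// mul1r sub0r.
have pD := minimal_sublinear_additive p sp pmin.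
have := pD v (- v); rewrite subrr sublinear0//; lra.
Qed.
End sublinear.

(** * Ekeland's variational principle *)

Section ekeland.
Context {R : realType} {X : completeNormedModType R}.
Context (C : set X) (phi : X -> R) (e m : R).
Context (e0 : 0 < e) (closedC : closed C) (cphi : continuous phi).
Context (phi_ge : forall x, C x -> m <= phi x).

(** The points of [C] reachable from [x] by a move whose gain in [phi] pays for
    its length at price [e]. This is a preorder, and a point that reaches only
    itself is what Ekeland's principle asks for. *)
Definition descent x : set X := [set y | C y /\ phi y + e * `|y - x| <= phi x].

Lemma descent_refl x : C x -> descent x x.
Proof. by move=> Cx; split; rewrite // subrr normr0 mulr0 addr0. Qed.

Lemma descent_trans x y z : descent x y -> descent y z -> descent x z.
Proof.
move=> [Cy yx] [Cz zy]; split=> //.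
have := ler_wpM2l (ltW e0) (ler_distD y z x); rewrite mulrDr; lra.
Qed.

(** Each step halves, at least, the possible gain that remains: this is a choice
    of precision that refers neither to the step number nor to the infimum. *)
Lemma descent_half x : C x ->
  exists2 y, descent x y &
    forall z, descent x z -> phi y <= (phi x + phi z) / 2.
Proof.
move=> Cx; pose A := phi @` descent x.
have infA : has_inf A.
  split; first by exists (phi x), x => //; exact: descent_refl.
  by exists m => _ [z [Cz _] <-]; exact: phi_ge.
have Ale z : descent x z -> inf A <= phi z.
  by move=> xz; apply: ge_inf; [exact: infA.2|exists z].
have := Ale x (descent_refl x Cx); rewrite le_eqVlt => /predU1P[ix|ix].
  exists x; first exact: descent_refl.
  by move=> z /Ale; rewrite ix; lra.
have d0 : 0 < (phi x - inf A) / 2 by lra.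
have [_ [y xy <-] yi] := inf_adherent d0 infA.
by exists y => // z /Ale; lra.
Qed.

(** Descending by halving steps gives a sequence that is Cauchy because its
    displacements are paid for by the bounded quantity [phi]. Its limit [x] is
    reachable from every step, so anything reachable from [x] is too, and the
    halving property at the limit leaves no strict gain. *)
Theorem ekeland : C !=set0 ->
  exists2 x, C x & forall y, C y -> phi x <= phi y + e * `|y - x|.
Proof.
move=> [x0 Cx0].
have /choice[F FP] : forall x, exists y, C x -> descent x y /\
    forall z, descent x z -> phi y <= (phi x + phi z) / 2.
  move=> x; have [Cx|nCx] := pselect (C x); last by exists x.
  by have [y] := descent_half x Cx; exists y.
pose u n := iter n F x0.
have Cu n : C (u n) by elim: n => //= n /FP[[]].
have uS n z : descent (u n) z -> phi (u n.+1) <= (phi (u n) + phi z) / 2.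
  exact: (FP _ (Cu n)).2.
have uD n k : descent (u n) (u (k + n)%N).
  elim: k => [|k IH]; first exact: descent_refl.
  exact: descent_trans IH (FP _ (Cu _)).1.
have phiu : nonincreasing_seq (phi \o u).
  move=> n k /subnK <- /=; have [_] := uD n (k - n)%N.
  by apply: le_trans; rewrite lerDl mulr_ge0// ltW.
have cvgphiu : cvgn (phi \o u).
  apply: nonincreasing_is_cvgn => //.
  by exists m => _ [n _ <-]; exact: phi_ge.
pose l := limn (phi \o u).
have lphi n : l <= phi (u n) by exact: nonincreasing_cvgn_ge.
have cu : cvgn u.
  apply/cauchy_cvgP/cauchy_exP => eps eps0.
  have el : l < l + e * eps by rewrite ltrDl mulr_gt0.
  have [N _ /(_ N (leqnn N)) Nl] := cvgr_lt _ cvgphiu _ el.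
  exists (u N); exists N => // k /= /subnK <-.
  rewrite -ball_normE /= distrC -(ltr_pM2l e0).
  by have [_] := uD N (k - N)%N; have := lphi (k - N + N)%N; move: Nl => /=; lra.
set x := limn u in cu.
have phix : phi x = l.
  apply/esym/cvg_lim => //.
  exact: (cvg_comp u phi cu (cphi x)).
have Cx : C x by apply: closed_cvg cu => //; exact: nearW.
have ux n : descent (u n) x.
  split=> //.
  have cv : (fun k => phi (u k) + e * `|u k - u n|) @ \oo -->
      phi x + e * `|x - u n|.
    apply: cvgD; first exact: (cvg_comp u phi cu (cphi x)).
    apply: cvgM; first exact: cvg_cst.
    by apply: cvg_norm; apply: cvgB => //; exact: cvg_cst.
  rewrite -(cvg_lim _ cv)//; apply: limr_le; first by apply/cvg_ex; eexists; exact: cv.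
  by exists n => // k /= /subnK <-; exact: (uD n _).2.
exists x => // y Cy; rewrite leNgt; apply/negP => yx.
have uy n : descent (u n) y by apply: descent_trans (ux n) _; split=> //; exact: ltW.
(* pass to the limit in the halving property of each step with respect to y *)
have : l <= (l + phi y) / 2.
  have cv : (fun n => (phi (u n) + phi y) / 2) @ \oo --> (l + phi y) / 2.
    by apply: cvgMl; apply: cvgD => //; exact: cvg_cst.
  rewrite -[leRHS](cvg_lim _ cv)//; apply: limr_ge.
    by apply/cvg_ex; eexists; exact: cv.
  by apply: nearW => n; apply: le_trans (uS n _ (uy n)).
have : 0 <= e * `|y - x| by rewrite mulr_ge0// ltW.
by move: yx; rewrite phix; lra.
Qed.
End ekeland.

(** * Supporting functionals of closed convex sets *)

Section support.
Context {R : realType}.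

Lemma dual_linear {X : normedModType R} (f : dual X) : linear f.
Proof. by case/set_mem: (dual_funP f). Qed.

Lemma dual_continuous {X : normedModType R} (f : dual X) : continuous f.
Proof. by case/set_mem: (dual_funP f). Qed.

Lemma dualZ {X : normedModType R} (f : dual X) (t : R) x : f (t *: x) = t * f x.
Proof.
have f0 : f 0 = 0.
  by have := dual_linear f (-1) 0 0; rewrite scaler0 addr0 scaleN1r addNr.
by have := dual_linear f t x 0; rewrite f0 !addr0.
Qed.

Lemma dualD {X : normedModType R} (f : dual X) x y : f (x + y) = f x + f y.
Proof. by rewrite -{1}(scale1r x) dual_linear scale1r. Qed.

Lemma dualB {X : normedModType R} (f : dual X) x y : f (x - y) = f x - f y.
Proof. by rewrite dualD -scaleN1r dualZ mulN1r. Qed.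

Lemma dual_of_le_norm {X : normedModType R} (p : X -> R) :
  linear (p : X -> R^o) -> (forall x, p x <= `|x|) ->
  exists f : dual X, f = p :> (X -> R).
Proof.
move=> plin ple.
have pD x y : p (x - y) = p x - p y.
  by rewrite addrC -scaleN1r plin scaleN1r addrC.
have pc : continuous (p : X -> R^o).
  move=> x; apply/cvgrPdist_lt => eps eps0; near=> y.
  apply: (@le_lt_trans _ _ `|x - y|); last first.
    by near: y; apply: (@cvgr_dist_lt _ _ _ (nbhs x) _ id x) => //; exact: cvg_id.
  by rewrite ler_norml lerNl opprB -!pD ple distrC ple.
by exists (Dual (mem_set (conj plin pc))).
Unshelve. all: by end_near. Qed.

Definition dist_to {X : normedModType R} (K : set X) h :=
  inf ((fun k => `|h - k|) @` K).

Lemma dist_to_le {X : normedModType R} (K : set X) h k :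
  K k -> dist_to K h <= `|h - k|.
Proof.
move=> Kk; apply: ge_inf; last by exists k.
by exists 0 => _ [j _ <-].
Qed.

Lemma sublinear_dist_to {X : normedModType R} (K : set X) :
  K 0 -> (forall h k, K h -> K k -> K (h + k)) ->
  (forall (t : R) k, 0 <= t -> K k -> K (t *: k)) ->
  sublinear (dist_to K).
Proof.
move=> K0 KD KZ; apply: sublinear_inf.
- by exists 0.
- by move=> x; exists 0.
- move=> x y h k Kh Kk; exists (h + k); first exact: KD.
  by rewrite opprD addrACA ler_normD.
- move=> t x k t0 Kk; exists (t *: k); first exact: KZ.
  by rewrite -scalerBr normrZ ger0_norm.
Qed.

Lemma convex_setP {X : lmodType R} (C : set X) : convex_set C ->
  forall x y (t : R), C x -> C y -> 0 <= t <= 1 -> C (t *: x + (1 - t) *: y).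
Proof.
move=> cC x y t Cx Cy /andP[t0 t1].
by have /set_mem := cC x y (Itv01 t0 t1) (mem_set Cx) (mem_set Cy).
Qed.

(** The cone generated by [C - x], described by feasible directions: with [C]
    convex, closure under sums is then a single convex combination. *)
Definition feasible {X : lmodType R} (C : set X) x : set X :=
  [set k | exists2 s : R, 0 < s & C (x + s *: k)].

Section feasible_cone.
Context {X : lmodType R}.
Context (C : set X) (x : X) (cC : convex_set C) (Cx : C x).

Lemma feasible0 : feasible C x 0.
Proof. by exists 1; rewrite // scaler0 addr0. Qed.

Lemma feasibleZ (t : R) k : 0 <= t -> feasible C x k -> feasible C x (t *: k).
Proof.
rewrite le_eqVlt => /predU1P[<- _|t0]; first by rewrite scale0r; exact: feasible0.
move=> [s s0 Cs]; exists (s / t); first exact: divr_gt0.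
by rewrite scalerA divfK// gt_eqF.
Qed.

Lemma feasibleD h k : feasible C x h -> feasible C x k -> feasible C x (h + k).
Proof.
move=> [s s0 Cs] [t t0 Ct]; have st0 : 0 < s + t by exact: addr_gt0.
(* x + (st / (s + t)) (h + k) lies between x + s h and x + t k *)
exists (s * t / (s + t)); first by rewrite divr_gt0// mulr_gt0.
have st01 : 0 <= t / (s + t) <= 1.
  by rewrite divr_ge0 ?(ltW t0) ?(ltW st0)//= ler_pdivrMr// mul1r lerDr (ltW s0).
have := convex_setP C cC _ _ _ Cs Ct st01.
have -> : 1 - t / (s + t) = s / (s + t) by field; rewrite gt_eqF.
congr (C _); rewrite !scalerDr addrACA -scalerDl -mulrDl addrC.
rewrite [t + s]addrC divff ?gt_eqF// scale1r addrC; congr (_ + (_ + _)).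
  by rewrite scalerA; congr (_ *: _); ring.
by rewrite scalerA; congr (_ *: _); ring.
Qed.

Lemma feasible_small k : feasible C x k ->
  exists2 s : R, 0 < s <= 1 & C (x + s *: k).
Proof.
move=> [s s0 Cs]; have [s1|/ltW s1] := leP s 1; first by exists s; rewrite ?s0.
exists 1; first by rewrite ltr01 lexx.
have si : 0 <= s^-1 <= 1 by rewrite invr_ge0 (ltW s0) invf_le1.
have := convex_setP C cC _ _ _ Cs Cx si; congr (C _).
by rewrite scalerDr addrAC -scalerDl subrKC !scale1r scalerA mulVf ?gt_eqF// scale1r.
Qed.

End feasible_cone.

(** Bishop-Phelps separation: the separating functional is attained on [C].
    Ekeland's principle for the distance to [x0] yields [x] in [C] from which no
    move in [C] approaches [x0] by more than half its length. Hence the direction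
    [x0 - x] stays away from the cone of feasible directions at [x], and
    Hahn-Banach applied to the distance to that cone gives a functional that is
    nonpositive on the cone and positive at [x0 - x]. *)
Theorem bishop_phelps {X : completeNormedModType R} (C : set X) x0 :
  C !=set0 -> closed C -> convex_set C -> ~ C x0 ->
  exists x (f : dual X),
    [/\ C x, forall y, C y -> f (y - x) <= 0 & 0 < f (x0 - x)].
Proof.
move=> C0 clC cC nCx0.
have [|||x Cx xmin] := ekeland C (fun y => `|y - x0|) (1 / 2) 0 _ clC _ _ C0.
- lra.
- move=> y; apply: cvg_norm; apply: cvgB => //; exact: cvg_cst.
- by [].
pose w := x0 - x; pose K := feasible C x.
have w0 : 0 < `|w|.
  by rewrite normr_gt0 subr_eq0; apply/eqP => xx0; apply: nCx0; rewrite xx0.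
(* If k were a feasible direction within |w|/4 of w, a short move s k would
   approach x0 by at least (3/4) s |w|, but its price is at most
   (1/2) (5/4) s |w| = (5/8) s |w|. *)
have distK : `|w| / 4 <= dist_to K w.
  apply: lb_le_inf; first by exists `|w - 0|, 0 => //; exact: feasible0.
  move=> _ [k Kk <-]; rewrite leNgt; apply/negP => wk.
  have [s /andP[s0 s1] Cs] := feasible_small C x cC Cx k Kk.
  have := xmin _ Cs; rewrite distrC -/w.
  have -> : x + s *: k - x = s *: k by rewrite addrAC subrr add0r.
  have -> : x + s *: k - x0 = - ((1 - s) *: w + s *: (w - k)).
    rewrite [s *: (w - k)]scalerBr addrA -scalerDl subrK scale1r opprB /w opprB.
    by rewrite addrCA addrA.
  rewrite normrN normrZ gtr0_norm//.
  have : `|(1 - s) *: w + s *: (w - k)| <= (1 - s) * `|w| + s * `|w - k|.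
    rewrite (le_trans (ler_normD _ _))// !normrZ (gtr0_norm s0) ger0_norm//.
    by rewrite subr_ge0.
  have : `|k| <= `|w| + `|w - k| by rewrite [`|w - k|]distrC -{1}(subrKC w k) ler_normD.
  nra.
have sd : sublinear (dist_to K).
  by apply: sublinear_dist_to;
    [exact: feasible0|exact: feasibleD|exact: feasibleZ].
have [p [plin ple pw]] := hahn_banach _ w sd.
have [|f fE] := dual_of_le_norm p plin.
  move=> h; apply: le_trans (ple h) _; rewrite -[leRHS]/(`|h|) -{2}[h]subr0.
  exact/dist_to_le/feasible0.
exists x, f; split => //; last by rewrite fE pw; lra.
move=> y Cy; rewrite fE; apply: le_trans (ple _) _.
rewrite -[leRHS](normr0 X) -(subrr (y - x)); apply: dist_to_le.
by exists 1; rewrite // scale1r addrC addrNK.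
Qed.
End support.

(** * Normal cones as maximally monotone operators *)

Section normal_cones.
Context {R : realType}.

Lemma normal_coneP {X : normedModType R} (C : set X) x (f : dual X) :
  C !=set0 ->
  normal_cone C x f <-> C x /\ forall y, C y -> f (y - x) <= 0.
Proof.
move=> [c Cc]; rewrite /normal_cone /subdifferential /indicator /pairing /=.
have [Cx|nCx] := pselect (C x); last first.
  split=> [|[]//] /(_ c); rewrite memNset// mem_set//.
split=> [fx|[_ fx] y].
  by split=> // y Cy; have := fx y; rewrite !mem_set// add0e lee_fin.
rewrite (mem_set Cx) add0e; case: ifPn => [/set_mem Cy|_]; last exact: leey.
by rewrite lee_fin fx.
Qed.

Lemma normal_cone_monotone {X : normedModType R} (C : set X) :
  C !=set0 -> Defs.monotone (normal_cone C).
Proof.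
move=> C0 [x f] [y g]; rewrite /graph /= => /(normal_coneP _ _ _ C0)[Cx fx].
move=> /(normal_coneP _ _ _ C0)[Cy gy]; rewrite /pairing -[leRHS]/(f (x - y) - g (x - y)).
by have := fx _ Cy; have := gy _ Cx; rewrite !dualB; lra.
Qed.

(** Let [(x0, g)] be monotonically related to the normal cone operator. Testing
    it against the pairs [(x, 0)] shows that [g] is nonpositive on [C - x0], so
    it only remains to see that [x0] lies in [C]. Otherwise take a supporting
    functional [f] at some [x] with [f (x0 - x) > 0]: its large multiples
    [t *: f] are also normal at [x], and violate monotonicity. *)
Lemma normal_cone_maximal {X : completeNormedModType R} (C : set X) :
  C !=set0 -> closed C -> convex_set C -> maximally_monotone (normal_cone C).
Proof.
move=> C0 clC cC; split; first exact: normal_cone_monotone.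
move=> S Smon [NS]; apply => -[x0 g] Sg.
have rel x (f : dual X) : C x -> (forall y, C y -> f (y - x) <= 0) ->
    0 <= f (x - x0) - g (x - x0).
  move=> Cx fx; apply: (Smon (x, f) (x0, g)) => //; apply: NS.
  exact/normal_coneP.
apply/normal_coneP => //; split; last first.
  by move=> y Cy; have := rel y 0 Cy (fun _ _ => lexx 0); rewrite sub0r oppr_ge0.
apply: contrapT => nCx0.
have [x [f [Cx fx f0]]] := bishop_phelps C x0 C0 clC cC nCx0.
(* t is such that t * f (x0 - x) exceeds g (x0 - x) *)
pose a := f (x0 - x); pose t := (`|g (x0 - x)| + 1) / a.
have t0 : 0 <= t by rewrite divr_ge0 ?(ltW f0)// addr_ge0.
have := rel x (t *: f) Cx.
rewrite -[(t *: f) (x - x0)]/(t * f (x - x0)).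
have -> : f (x - x0) = - a by rewrite /a !dualB opprB.
have -> : g (x - x0) = - g (x0 - x) by rewrite !dualB opprB.
rewrite mulrN divfK ?gt_eqF// opprK => h.
suff : 0 <= - (`|g (x0 - x)| + 1) + g (x0 - x) by have := ler_norm (g (x0 - x)); lra.
apply: h => y Cy; rewrite -[leLHS]/(t * f (y - x)).
by rewrite mulr_ge0_le0// fx.
Qed.

Lemma maximally_monotone_eq {X : normedModType R} (T S : X -> set (dual X)) :
  maximally_monotone T -> Defs.monotone S -> graph T `<=` graph S -> T = S.
Proof.
move=> [_ Tmax] Smon TS; apply/funext => x; apply/seteqP; split=> f.
  exact: (TS (x, f)).
move=> Sf; apply: contrapT => nTf; apply: (Tmax S Smon); split=> //.
by move=> /(_ (x, f) Sf).
Qed.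

(** The empty operator is properly contained in the monotone operator with
    graph [{(0, 0)}]. *)
Lemma maximally_monotone_dom {X : normedModType R} (T : X -> set (dual X)) :
  maximally_monotone T -> dom T !=set0.
Proof.
move=> Tmax; pose S (x : X) := [set f : dual X | x = 0 /\ f = 0].
apply: contrapT => domT.
have TE x f : ~ T x f by move=> Tf; apply: domT; exists x, f.
have Smon : Defs.monotone S.
  move=> [_ _] [_ _] [/= -> ->] [/= -> ->].
  by rewrite /pairing -[leRHS]/((0 : R) - 0) subr0.
have TS : graph T `<=` graph S by move=> [x f] /TE.
have /(TE 0 0) // : T 0 0 by rewrite (maximally_monotone_eq T S Tmax Smon TS).
Qed.

(** The largest set to which every pair of [T] can be normal. A nonempty closed
    convex set is recovered in this way from its normal cone operator, by
    [bishop_phelps]. *)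
Definition graph_halfspaces {X : normedModType R} (T : X -> set (dual X)) :
    set X :=
  [set x | forall y f, T y f -> f (x - y) <= 0].

Lemma graph_halfspaces_closed {X : normedModType R} (T : X -> set (dual X)) :
  closed (graph_halfspaces T).
Proof.
have -> : graph_halfspaces T =
    \bigcap_(p in graph T) [set x | p.2 (x - p.1) <= 0].
  apply/seteqP; split=> x Tx; first by move=> [y f] /Tx.
  by move=> y f Tf; exact: (Tx (y, f)).
apply: closed_bigI => -[y f] _ /=.
apply: (@closed_comp _ _ (fun x => f (x - y)) [set r : R | r <= 0]).
  move=> x _; apply: (@continuous_comp _ _ _ (fun x => x - y) f).
    by apply: cvgB => //; exact: cvg_cst.
  exact: dual_continuous.
exact: closed_le.
Qed.

Lemma graph_halfspaces_convex {X : normedModType R} (T : X -> set (dual X)) :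
  convex_set (graph_halfspaces T).
Proof.
move=> x z t /set_mem Tx /set_mem Tz; apply/mem_set => y f Tf.
have := Tx y f Tf; have := Tz y f Tf; rewrite !dualB.
have -> : conv t x z = t%:num *: x + (1 - t%:num) *: z :> X by [].
rewrite dualD !dualZ.
have : 0 <= t%:num <= 1 by rewrite ge0 le1.
nra.
Qed.
End normal_cones.

Theorem theorem2p1 (R : realType) (X : completeNormedModType R)
    (T : X -> set (dual X)) :
  (exists C : set X,
    [/\ C !=set0, closed C, convex_set C & T = normal_cone C]) <->
  (maximally_monotone T /\ (\bigcap_(x in dom T) T x) (0 : dual X)).
Proof.
split=> [[C [C0 clC cC ->]]|[Tmax T0]].
  split; first exact: normal_cone_maximal.
  by move=> x [f /(normal_coneP _ _ _ C0)[Cx _]]; apply/normal_coneP.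
have domC : dom T `<=` graph_halfspaces T.
  move=> x domx y f Tf.
  have := Tmax.1 (y, f) (x, 0) Tf (T0 x domx).
  rewrite /pairing -[leRHS]/(f (y - x) - 0) subr0 !dualB; lra.
have C0 : graph_halfspaces T !=set0.
  by have [x /domC] := maximally_monotone_dom T Tmax; exists x.
exists (graph_halfspaces T); split=> //.
- exact: graph_halfspaces_closed.
- exact: graph_halfspaces_convex.
apply: maximally_monotone_eq => //; first exact: normal_cone_monotone.
move=> [x f] Tf; apply/normal_coneP => //; split; first by apply: domC; exists f.
by move=> y /(_ x f Tf).
Qed.
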